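(* Let $(\mathbf{A},\mathbf{E})$ be a regular matrix pencil, $\mathbf{A},\mathbf{E}\in\mathbb{C}^{n\times n}$. Let the columns of $\mathbf{V}\in\mathbb{C}^{n\times k}$ form an orthonormal basis for a $k$-dimensional invariant subspace of $(\mathbf{A},\mathbf{E})$ associated with finite eigenvalues, and let $\mu\in\mathbb{C}$ be any number for which $\mathbf{A}-\mu\mathbf{E}$ is invertible. Then for all $\varepsilon>0$, $$\sigma_\varepsilon(\widehat{\mathbf{G}}^{-1}+\mu\mathbf{I})\subseteq\sigma_\varepsilon(\mathbf{A},\mathbf{E}),$$ where $\widehat{\mathbf{G}}=\mathbf{V}^*(\mathbf{A}-\mu\mathbf{E})^{-1}\mathbf{E}\mathbf{V}$.
   Context: $\|\cdot\|$ is the Euclidean vector norm and the matrix norm it induces, with the convention $\|\mathbf{X}^{-1}\|=\infty$ when $\mathbf{X}$ is a square matrix that is not invertible; orthonormality is with respect to the Euclidean inner product. The pencil $(\mathbf{A},\mathbf{E})$ is regular if $\mathbf{A}-\mu\mathbf{E}$ is invertible for some $\mu\in\mathbb{C}$. An invariant subspace of $(\mathbf{A},\mathbf{E})$ associated with finite eigenvalues means a subspace that is invariant under $\mathbf{E}_\nu:=(\mathbf{A}-\nu\mathbf{E})^{-1}\mathbf{E}$ and on which $\mathbf{E}_\nu$ has only nonzero eigenvalues, for $\nu\in\mathbb{C}$ with $\mathbf{A}-\nu\mathbf{E}$ invertible (this property does not depend on the choice of such $\nu$). For a square matrix $\mathbf{B}$, $\sigma_\varepsilon(\mathbf{B}):=\{z\in\mathbb{C}:\|(z\mathbf{I}-\mathbf{B})^{-1}\|>1/\varepsilon\}$.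 For $\mu\in\mathbb{C}$ with $\mathbf{A}-\mu\mathbf{E}$ invertible, let $d$ be the algebraic multiplicity of $0$ as an eigenvalue of $\mathbf{E}_\mu:=(\mathbf{A}-\mu\mathbf{E})^{-1}\mathbf{E}$, and take a Schur factorization $$\mathbf{E}_\mu=[\mathbf{Q}_\mu\ \widetilde{\mathbf{Q}}_\mu]\begin{bmatrix}\mathbf{G}_\mu&\mathbf{D}_\mu\\ \mathbf{0}&\mathbf{N}_\mu\end{bmatrix}[\mathbf{Q}_\mu\ \widetilde{\mathbf{Q}}_\mu]^*$$ with $[\mathbf{Q}_\mu\ \widetilde{\mathbf{Q}}_\mu]$ unitary, the middle factor upper triangular, $\mathbf{N}_\mu\in\mathbb{C}^{d\times d}$ nilpotent, and $\mathbf{G}_\mu\in\mathbb{C}^{(n-d)\times(n-d)}$ with $0\notin\sigma(\mathbf{G}_\mu)$. The $\varepsilon$-pseudospectrum of the pencil is $\sigma_\varepsilon(\mathbf{A},\mathbf{E}):=\{z\in\mathbb{C}:\|(z\mathbf{I}-(\mathbf{G}_\mu^{-1}+\mu\mathbf{I}))^{-1}\|>1/\varepsilon\}$, which is independent of the choice of $\mu$ and of the Schur factorization. *)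

(* Defs.v *)
From HB Require Import structures.
From mathcomp Require Import all_boot all_order all_algebra.
From mathcomp Require Import all_classical all_reals.
From mathcomp Require Import complex.

Set Implicit Arguments.
Unset Strict Implicit.
Unset Printing Implicit Defensive.

Import Order.TTheory GRing.Theory Num.Theory.

Local Open Scope classical_set_scope.
Local Open Scope ring_scope.
Local Open Scope sesquilinear_scope.
Local Open Scope complex_scope.

(* The complex numbers are R[i] for an arbitrary realType R.  Norms take their
   values in R (or \bar R), so that suprema are available. *)

Definition enorm (R : realType) (n : nat) (x : 'cV[R[i]]_n) : R :=
  Num.sqrt (\sum_(i < n) ComplexField.Normc.normc (x i 0) ^+ 2).

(* The unit ball is used rather than the unit sphere because the latter is
   empty when n = 0. *)
Definition opnorm (R : realType) (m n : nat) (X : 'M[R[i]]_(m, n)) : R :=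
  sup [set enorm (X *m x) | x in [set x : 'cV[R[i]]_n | enorm x <= 1]].

(* ||X^-1||, equal to +oo when X is singular: invmx is total and would return X
   in that case. *)
Definition inv_opnorm (R : realType) (n : nat) (X : 'M[R[i]]_n) : \bar R :=
  if X \in unitmx then (opnorm (invmx X))%:E else +oo%E.

Definition pseudospectrum (R : realType) (n : nat) (eps : R)
    (B : 'M[R[i]]_n) : set R[i] :=
  [set z : R[i] | ((1 / eps)%:E < inv_opnorm (z%:M - B))%E].

Definition regular_pencil (R : realType) (n : nat) (A E : 'M[R[i]]_n) : Prop :=
  exists mu : R[i], A - mu *: E \in unitmx.

Definition shift_invert (R : realType) (n : nat) (A E : 'M[R[i]]_n)
    (mu : R[i]) : 'M[R[i]]_n :=
  invmx (A - mu *: E) *m E.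

(* The property does not depend on nu; as it is used as a hypothesis, it is
   required for some nu only. *)
Definition finite_invariant_subspace (R : realType) (n : nat)
    (A E : 'M[R[i]]_n) (S : {vspace 'cV[R[i]]_n}) : Prop :=
  exists nu : R[i],
    [/\ A - nu *: E \in unitmx,
        forall x, x \in S -> shift_invert A E nu *m x \in S
      & forall (lambda : R[i]) (x : 'cV[R[i]]_n),
          x \in S -> x != 0 -> shift_invert A E nu *m x = lambda *: x ->
          lambda != 0].

Definition orthonormal_basis (R : realType) (n k : nat) (V : 'M[R[i]]_(n, k))
    (S : {vspace 'cV[R[i]]_n}) : Prop :=
  basis_of S [tuple col j V | j < k] /\ V ^t* *m V = 1%:M.

(* A choice of mu together with an ordered Schur factorization of E_mu.  The
   dimension n - d is a separate field ps_rank, tied to n by ps_dim, which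
   avoids casts along (n - d + d)%N = n.  is_trig_mx means lower triangular,
   hence the transpose. *)
Record pencil_schur (R : realType) (n : nat) (A E : 'M[R[i]]_n) := PencilSchur {
  ps_shift : R[i];
  ps_rank : nat;
  ps_mult : nat;
  ps_Q : 'M[R[i]]_(n, ps_rank);
  ps_Qt : 'M[R[i]]_(n, ps_mult);
  ps_G : 'M[R[i]]_ps_rank;
  ps_D : 'M[R[i]]_(ps_rank, ps_mult);
  ps_N : 'M[R[i]]_ps_mult;
  ps_shift_unit : A - ps_shift *: E \in unitmx;
  ps_multE : ps_mult = mup 0 (char_poly (shift_invert A E ps_shift));
  ps_dim : (ps_rank + ps_mult)%N = n;
  ps_isometry : (row_mx ps_Q ps_Qt) ^t* *m row_mx ps_Q ps_Qt = 1%:M;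
  ps_coisometry : row_mx ps_Q ps_Qt *m (row_mx ps_Q ps_Qt) ^t* = 1%:M;
  ps_factorization :
    shift_invert A E ps_shift =
      row_mx ps_Q ps_Qt *m block_mx ps_G ps_D 0 ps_N *m (row_mx ps_Q ps_Qt) ^t*;
  ps_triangular : is_trig_mx (block_mx ps_G ps_D 0 ps_N)^T;
  ps_nilpotent : exists p : nat, ps_N ^+ p = 0;
  ps_nonsingular : ~~ eigenvalue ps_G 0
}.

(* sigma_eps(A, E) computed from the data F; it does not depend on F. *)
Definition pencil_pseudospectrum (R : realType) (n : nat) (A E : 'M[R[i]]_n)
    (F : pencil_schur A E) (eps : R) : set R[i] :=
  pseudospectrum eps (invmx (ps_G F) + (ps_shift F)%:M).

(* Main.v *)
(** Writing E_nu V = V H with H invertible gives A V = E V M for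
    M = H^-1 + nu I, and M no longer refers to nu.  For every admissible shift
    mu this says E_mu V (M - mu I) = V; multiplying by V^* yields
    Ghat^-1 + mu I = M.  Applied to the shift omega of the Schur
    factorization, with b the component of V along the nilpotent block, it
    gives b = N b (M - omega I), hence b = N^j b (M - omega I)^j = 0.  So
    V = Q a with a an isometry and (G^-1 + omega I) a = a M, and such an
    intertwining bounds the resolvent norm of M by that of G^-1 + omega I. *)

Require Import Defs.
From HB Require Import structures.
From mathcomp Require Import all_boot all_order all_algebra.
From mathcomp Require Import all_classical all_reals.
From mathcomp Require Import complex.

Set Implicit Arguments.
Unset Strict Implicit.
Unset Printing Implicit Defensive.

Import Order.TTheory GRing.Theory Num.Theory.

Local Open Scope classical_set_scope.
Local Open Scope ring_scope.
Local Open Scope sesquilinear_scope.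
Local Open Scope complex_scope.

(** Links the real-valued norm to a matrix product over [R[i]], so that norm identities reduce to
    matrix algebra. *)
Lemma sqr_enorm (R : realType) (n : nat) (x : 'cV[R[i]]_n) :
  ((enorm x ^+ 2)%:C = (x ^t* *m x) 0 0)%C.
Proof.
rewrite /enorm sqr_sqrtr; last by apply: sumr_ge0 => i _; exact: sqr_ge0.
rewrite rmorph_sum mxE; apply: eq_bigr => i _.
by rewrite !mxE rmorphXn /= mulrC -normCK.
Qed.

Lemma enorm_ge0 (R : realType) (n : nat) (x : 'cV[R[i]]_n) : 0 <= enorm x.
Proof. exact: sqrtr_ge0. Qed.

Lemma enorm_isometry (R : realType) (n k : nat) (U : 'M[R[i]]_(n, k))
    (x : 'cV[R[i]]_k) :
  U ^t* *m U = 1%:M -> enorm (U *m x) = enorm x.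
Proof.
move=> UU; apply/eqP; rewrite -(@eqrXn2 _ 2) ?enorm_ge0 //; apply/eqP.
apply: complexI; rewrite !sqr_enorm.
by rewrite trmx_mul map_mxM -mulmxA (mulmxA _ U) UU mul1mx.
Qed.

Lemma normc_ge0 (R : rcfType) (z : R[i]) : 0 <= ComplexField.Normc.normc z.
Proof. by case: z => a b; exact: sqrtr_ge0. Qed.

Lemma normc_le_enorm (R : realType) (n : nat) (x : 'cV[R[i]]_n) (i : 'I_n) :
  ComplexField.Normc.normc (x i 0) <= enorm x.
Proof.
rewrite -[leLHS]ger0_norm ?normc_ge0 // -sqrtr_sqr ler_wsqrtr //.
rewrite (bigD1 i) //= lerDl.
by apply: sumr_ge0 => j _; exact: sqr_ge0.
Qed.

(** Without this bound the [sup] in [opnorm] need not dominate the set. Entries of a vector in the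
    unit ball have modulus at most 1, so each entry of [X *m x] is at most the absolute sum of its
    row of [X]. *)
Lemma has_ubound_opnorm (R : realType) (m n : nat) (X : 'M[R[i]]_(m, n)) :
  has_ubound
    [set enorm (X *m x) | x in [set x : 'cV[R[i]]_n | enorm x <= 1]].
Proof.
exists (Num.sqrt
  (\sum_(i < m) (\sum_(j < n) ComplexField.Normc.normc (X i j)) ^+ 2)).
move=> _ [x xle1 <-]; apply/ler_wsqrtr/ler_sum => i _.
rewrite lerXn2r ?nnegrE ?normc_ge0 ?sumr_ge0 // => [j _|];
  first exact: normc_ge0.
rewrite mxE.
elim/big_rec2: _ => [|j u v _ uv]; first by rewrite ComplexField.Normc.normc0.
apply: (le_trans (le_normcD _ _)); apply: lerD uv.
rewrite ComplexField.Normc.normcM ler_piMr ?normc_ge0 //.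
exact: le_trans (normc_le_enorm _ _) xle1.
Qed.

(* The resolvents are intertwined as well, U (z - C)^-1 = (z - B)^-1 U, and U
   maps the unit ball isometrically into the unit ball. *)
Lemma pseudospectrum_isometry (R : realType) (r k : nat) (eps : R)
    (U : 'M[R[i]]_(r, k)) (B : 'M[R[i]]_r) (C : 'M[R[i]]_k) :
  U ^t* *m U = 1%:M -> B *m U = U *m C ->
  pseudospectrum eps C `<=` pseudospectrum eps B.
Proof.
move=> UU BU z; rewrite /pseudospectrum /= /inv_opnorm.
have [zB|_ _] := boolP (z%:M - B \in unitmx); last by rewrite ltry.
have zBU : (z%:M - B) *m U = U *m (z%:M - C).
  by rewrite mulmxBl mulmxBr BU mul_scalar_mx mul_mx_scalar.
(* The compression [U ^t* *m invmx (z%:M - B) *m U] is a left inverse, which suffices for a square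
   matrix. *)
have zC : z%:M - C \in unitmx.
  have inv1 : (U ^t* *m invmx (z%:M - B) *m U) *m (z%:M - C) = 1%:M.
    by rewrite -!mulmxA -zBU (mulKmx zB).
  by case: (mulmx1_unit inv1).
have inter : U *m invmx (z%:M - C) = invmx (z%:M - B) *m U.
  by rewrite -[LHS](mulKmx zB) (mulmxA _ U) zBU -mulmxA mulmxV // mulmx1.
rewrite zC => /lt_le_trans; apply; rewrite lee_fin; apply: ge_sup.
  (* The zero vector shows that the set under the supremum is nonempty, in every dimension. *)
  by exists (enorm (invmx (z%:M - C) *m 0)), 0 => //=;
    rewrite /enorm big1 ?sqrtr0 // => i _;
    rewrite mxE ComplexField.Normc.normc0 expr0n.
move=> _ [x xle1 <-]; apply: ub_le_sup; first exact: has_ubound_opnorm.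
exists (U *m x) => /=; first by rewrite enorm_isometry.
by rewrite mulmxA -inter -mulmxA enorm_isometry.
Qed.

(** [H] is the compression [V ^t* *m K *m V]: since [V *m V ^t*] fixes [S] pointwise, invariance
    gives [K *m V = V *m H]. A kernel vector of [H] would be sent by [V] to an eigenvector of [K] in
    [S] with eigenvalue 0. *)
Lemma invariant_subspace_mx (R : realType) (n k : nat) (K : 'M[R[i]]_n)
    (S : {vspace 'cV[R[i]]_n}) (V : 'M[R[i]]_(n, k)) :
  orthonormal_basis V S -> (forall x, x \in S -> K *m x \in S) ->
  (forall (lambda : R[i]) (x : 'cV[R[i]]_n),
     x \in S -> x != 0 -> K *m x = lambda *: x -> lambda != 0) ->
  exists2 H : 'M[R[i]]_k, H \in unitmx & K *m V = V *m H.
Proof.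
move=> [Vbasis VV] KS Kneq0.
have mulVE (x : 'cV_k) : V *m x = \sum_j x j 0 *: col j V.
  apply/colP => i; rewrite mxE summxE; apply: eq_bigr => j _.
  by rewrite !mxE mulrC.
have memV (x : 'cV_k) : V *m x \in S.
  rewrite mulVE; apply: memv_suml => j _; apply: memvZ.
  apply: (basis_mem Vbasis); apply/mapP.
  by exists j; rewrite ?mem_enum.
have projV (x : 'cV_n) : x \in S -> V *m (V ^t* *m x) = x.
  move=> xS; suff [c ->] : exists c, x = V *m c.
    by rewrite (mulmxA _ V) VV mul1mx.
  exists (\col_j coord [tuple col j V | j < k] j x).
  rewrite {1}(coord_basis Vbasis xS) mulVE; apply: eq_bigr => j _.
  by rewrite mxE (nth_map j) ?size_enum_ord // nth_ord_enum.
have KV : K *m V = V *m (V ^t* *m (K *m V)).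
  apply: trmx_inj; apply/row_matrixP => j; rewrite -!tr_col !colE.
  rewrite -!(mulmxA V) -(mulmxA _ (K *m V)) projV // -mulmxA.
  exact: KS (memV _).
exists (V ^t* *m (K *m V)) => //.
(* [kermx] is a left kernel, so the column kernel of [H] is reached through its transpose. *)
rewrite -unitmx_tr -row_free_unit -kermx_eq0.
apply/negPn/negP => /rowV0Pn [v /sub_kermxP vH v0].
have Hv : V ^t* *m (K *m V) *m v^T = 0.
  by apply: trmx_inj; rewrite trmx_mul trmxK vH trmx0.
suff /(Kneq0 0 _ (memV v^T)) : V *m v^T != 0.
  move=> /(_ _)/eqP; apply => //.
  by rewrite scale0r mulmxA KV -mulmxA Hv mulmx0.
apply: contraNneq v0 => Vv.
by rewrite -trmx_eq0 -[v^T]mul1mx -VV -mulmxA Vv mulmx0.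
Qed.

Lemma invariant_pencil (R : realType) (n k : nat) (A E : 'M[R[i]]_n)
    (S : {vspace 'cV[R[i]]_n}) (V : 'M[R[i]]_(n, k)) :
  orthonormal_basis V S -> finite_invariant_subspace A E S ->
  exists M : 'M[R[i]]_k, A *m V = E *m V *m M.
Proof.
move=> VS [nu [nuU KS Kneq0]].
have [H Hunit KV] := invariant_subspace_mx VS KS Kneq0.
exists (invmx H + nu%:M).
(* Solving this for [(A - nu *: E) *m V] gives [E *m V *m invmx H]; moving the [nu] term across
   yields [M]. *)
have EV : E *m V = (A - nu *: E) *m V *m H.
  by rewrite -mulmxA -KV /shift_invert mulmxA mulKVmx.
rewrite mulmxDr EV (mulmxK Hunit) -EV mul_mx_scalar mulmxBl -scalemxAl.
by rewrite subrK.
Qed.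

(** Subtracting [mu *: (E *m V)] from both sides of the pencil equation gives [(A - mu *: E) *m V =
    E *m V *m (M - mu%:M)]. *)
Lemma shift_invert_pencil (R : realType) (n k : nat) (A E : 'M[R[i]]_n)
    (V : 'M[R[i]]_(n, k)) (M : 'M[R[i]]_k) (mu : R[i]) :
  A *m V = E *m V *m M -> A - mu *: E \in unitmx ->
  shift_invert A E mu *m V *m (M - mu%:M) = V.
Proof.
move=> AV muU; rewrite /shift_invert -!mulmxA.
apply: (canLR (mulKmx muU)).
by rewrite !mulmxBr mulmxBl mulmxA AV mul_mx_scalar -scalemxAl -scalemxAr.
Qed.

Lemma nilpotent_intertwining (K : fieldType) (d k : nat) (N : 'M[K]_d)
    (b : 'M[K]_(d, k)) (L : 'M[K]_k) :
  (exists p : nat, N ^+ p = 0) -> b = N *m b *m L -> b = 0.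
Proof.
move=> [p Np] bE.
have bEX j : b = N ^+ j *m b *m L ^+ j.
  elim: j => [|j IHj]; first by rewrite !expr0 mul1mx mulmx1.
  by rewrite exprSr exprS {1}IHj {1}bE !mulmxA.
by rewrite (bEX p) Np !mul0mx.
Qed.

Lemma ps_G_unit (R : realType) (n : nat) (A E : 'M[R[i]]_n)
    (F : pencil_schur A E) : ps_G F \in unitmx.
Proof.
have := ps_nonsingular F.
by rewrite /eigenvalue /eigenspace raddf0 subr0 negbK kermx_eq0 row_free_unit.
Qed.

Theorem theorem5p1 (R : realType) (n k : nat) (A E : 'M[R[i]]_n)
    (S : {vspace 'cV[R[i]]_n}) (V : 'M[R[i]]_(n, k)) (mu : R[i]) :
  regular_pencil A E ->
  finite_invariant_subspace A E S ->
  orthonormal_basis V S ->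
  A - mu *: E \in unitmx ->
  forall (F : pencil_schur A E) (eps : R), 0 < eps ->
    pseudospectrum eps
      (invmx (V ^t* *m invmx (A - mu *: E) *m E *m V) + mu%:M)
    `<=` pencil_pseudospectrum F eps.
Proof.
move=> _ invS VS muU F eps _.
have [_ VV] := VS.
have [M AV] := invariant_pencil VS invS.
have -> : invmx (V ^t* *m invmx (A - mu *: E) *m E *m V) + mu%:M = M.
  have GM : (V ^t* *m invmx (A - mu *: E) *m E *m V) *m (M - mu%:M) = 1%:M.
    have := shift_invert_pencil AV muU; rewrite /shift_invert => VE.
    by rewrite -!(mulmxA (V ^t*)) VE.
  have [GU _] := mulmx1_unit GM.
  by rewrite -[invmx _]mulmx1 -GM (mulKmx GU) subrK.
pose L := M - (ps_shift F)%:M.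
pose a := (ps_Q F) ^t* *m V; pose b := (ps_Qt F) ^t* *m V.
have cE : (row_mx (ps_Q F) (ps_Qt F)) ^t* *m V = col_mx a b.
  by rewrite tr_row_mx map_col_mx mul_col_mx.
(* The relation for the shift of [F], read in the Schur coordinates of [V]; its lower block involves
   [b] alone. *)
have : col_mx a b = block_mx (ps_G F) (ps_D F) 0 (ps_N F) *m col_mx a b *m L.
  rewrite -cE -{1}(shift_invert_pencil AV (ps_shift_unit F)) ps_factorization.
  by rewrite -!mulmxA [LHS]mulmxA ps_isometry mul1mx.
rewrite mul_block_col mul_col_mx mul0mx add0r => /eq_col_mx [aE bE].
have b0 : b = 0 by apply: nilpotent_intertwining (ps_nilpotent F) bE.
apply: (@pseudospectrum_isometry _ _ _ _ a).
  (* Hence [a ^t* *m a = V ^t* *m (ps_Q F *m a) = V ^t* *m V], the identity. *)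
  have QaV : ps_Q F *m a = V.
    rewrite -[RHS]mul1mx -(ps_coisometry F) -mulmxA cE b0 mul_row_col.
    by rewrite mulmx0 addr0.
  by rewrite trmx_mul map_mxM trmxCK -mulmxA QaV.
(* What remains is [a = ps_G F *m a *m L], so [invmx (ps_G F) *m a = a *m L]; adding the shift back
   turns [L] into [M]. *)
rewrite b0 mulmx0 addr0 in aE.
by rewrite mulmxDl {1}aE -mulmxA (mulKmx (ps_G_unit F)) mulmxBr
  mul_mx_scalar mul_scalar_mx subrK.
Qed.
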